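(* Let $\lambda, R, B>0$ and $d,n\geq 1$. Let $(x_1,y_1),\dots,(x_n,y_n)$ be an arbitrary sequence with $x_t\in\mathbb R^d$, $\|x_t\|\le R$ and $y_t\in\{-1,1\}$. Then the AIOLI forecaster run with regularization parameter $\lambda$ (defined in the context) satisfies, for every $\theta\in\mathbb R^d$ with $\|\theta\|\le B$, \[ R_n(\theta)\le \lambda\|\theta\|^2 + d(1+BR)\log\left(1+\frac{nR^2}{8d(1+BR)\lambda}\right). \] In particular, with $\lambda = 1/B^2$, for every $\theta$ with $\|\theta\|\le B$, \[ R_n(\theta)\le d(1+BR)\log\left(1+\frac{nB^2R^2}{8d(1+BR)}\right)+1 . \]
   Context: Online logistic regression: the logistic loss is $\ell(z,y)=\log(1+e^{-yz})$ for $z\in\mathbb R$, $y\in\{-1,1\}$, and $\ell_t(\theta)=\ell(\theta^\top x_t,y_t)$ for $\theta\in\mathbb R^d$. AIOLI with parameters $\lambda,R,B$ produces vectors $\hat\theta_1,\dots,\hat\theta_n\in\mathbb R^d$ recursively: at round $t$, having $\hat\theta_1,\dots,\hat\theta_{t-1}$, for each $s<t$ set $g_s=\nabla\ell_s(\hat\theta_s)$, $\eta_s = e^{y_s\hat\theta_s^\top x_s}/(1+BR)$, and the quadratic surrogate \[\hat\ell_s(\theta)=\ell_s(\hat\theta_s)+g_s^\top(\theta-\hat\theta_s)+\frac{\eta_s}{2}(\theta-\hat\theta_s)^\top g_sg_s^\top(\theta-\hat\theta_s).\] Then, after observing $x_t$ (but before $y_t$), \[\hat\theta_t=\arg\min_{\theta\in\mathbb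 R^d}\Big\{\sum_{s=1}^{t-1}\hat\ell_s(\theta)+\ell(\theta^\top x_t,1)+\ell(\theta^\top x_t,-1)+\lambda\|\theta\|^2\Big\},\] and the prediction is $\hat y_t=\hat\theta_t^\top x_t$; then $y_t$ is revealed. The regret against $\theta\in\mathbb R^d$ is $R_n(\theta)=\sum_{t=1}^n\ell_t(\hat\theta_t)-\sum_{t=1}^n\ell_t(\theta)$. *)

(* Defs.v *)
(* R : realType, vectors in R^d are row vectors 'rV[R]_d,
   exp/log from mathcomp-analysis (expR, ln). Rounds are 0-indexed: round t
   of the paper is index t-1 here. *)
From HB Require Import structures.
From mathcomp Require Import all_boot all_order all_algebra.
From mathcomp Require Import all_classical all_reals all_analysis.
Set Implicit Arguments. Unset Strict Implicit. Unset Printing Implicit Defensive.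
Import Order.TTheory GRing.Theory Num.Theory.
Local Open Scope ring_scope.

Section AIOLI.
Variable R : realType.
Variable d : nat.

Definition dotp (u v : 'rV[R]_d) : R := \sum_(i < d) u 0 i * v 0 i.
Definition enorm (u : 'rV[R]_d) : R := Num.sqrt (dotp u u).

Definition logloss (z y : R) : R := ln (1 + expR (- (y * z))).

Definition lossAt (x : nat -> 'rV[R]_d) (y : nat -> R) (t : nat)
  (th : 'rV[R]_d) : R := logloss (dotp th (x t)) (y t).

Definition gradAt (x : nat -> 'rV[R]_d) (y : nat -> R) (t : nat)
  (th : 'rV[R]_d) : 'rV[R]_d :=
  (- (y t) / (1 + expR (y t * dotp th (x t)))) *: x t.

Definition etaAt (Rb B : R) (x : nat -> 'rV[R]_d) (y : nat -> R) (t : nat)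
  (th : 'rV[R]_d) : R := expR (y t * dotp th (x t)) / (1 + B * Rb).

(* quadratic surrogate hat l_s(theta); note
   (theta-a)^T g g^T (theta-a) = (g^T (theta-a))^2 *)
Definition surrogate (Rb B : R) (x : nat -> 'rV[R]_d) (y : nat -> R)
  (s : nat) (ths : 'rV[R]_d) (th : 'rV[R]_d) : R :=
  let g := gradAt x y s ths in
  lossAt x y s ths + dotp g (th - ths)
  + etaAt Rb B x y s ths / 2 * (dotp g (th - ths)) ^+ 2.

Definition aioli_obj (lam Rb B : R) (x : nat -> 'rV[R]_d) (y : nat -> R)
  (thhat : nat -> 'rV[R]_d) (t : nat) (th : 'rV[R]_d) : R :=
  \sum_(s < t) surrogate Rb B x y s (thhat s) th
  + logloss (dotp th (x t)) 1 + logloss (dotp th (x t)) (-1)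
  + lam * enorm th ^+ 2.

(* thhat is the sequence of AIOLI iterates over rounds 0..n-1: each thhat t
   is an argmin of the round-t objective (the objective is strictly convex,
   so the argmin is unique and this determines thhat). *)
Definition is_aioli (lam Rb B : R) (n : nat) (x : nat -> 'rV[R]_d)
  (y : nat -> R) (thhat : nat -> 'rV[R]_d) : Prop :=
  forall t, (t < n)%N ->
    forall th, aioli_obj lam Rb B x y thhat t (thhat t)
               <= aioli_obj lam Rb B x y thhat t th.

Definition regret (n : nat) (x : nat -> 'rV[R]_d) (y : nat -> R)
  (thhat : nat -> 'rV[R]_d) (th : 'rV[R]_d) : R :=
  \sum_(t < n) lossAt x y t (thhat t) - \sum_(t < n) lossAt x y t th.

End AIOLI.

(* Main.v *)
(* With g_s, eta_s as in the definition of the surrogates, let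
   A_t = 2 lam I + sum_(s < t) eta_s g_s g_s^T and let L_t be the sum of the
   first t surrogates plus lam ||.||^2, so that A_t is the Hessian of L_t.
   Since f = log(1 + exp(-.)) satisfies
   f(b) >= f(a) + f'(a)(b - a) + f''(a)(b - a)^2 / (2 (1 + C)) for |b| <= C,
   the surrogates lie below the losses on the ball of radius B.
   Stationarity of the iterate gives
   grad L_t(thhat_t) = (exp(y_t thhat_t.x_t) - 1) g_t, whence the cumulative
   loss of the forecaster is at most
   L_t(th) + (1 + B R) log(det A_t / det A_0) for every th, by induction on t.
   Hadamard's inequality and AM-GM bound det A_n by (tr A_n / d)^d. *)
Require Import Defs.
From HB Require Import structures.
From mathcomp Require Import all_boot all_order all_algebra.
From mathcomp Require Import all_classical all_reals all_analysis.
From mathcomp Require Import ring lra.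
Import Order.TTheory GRing.Theory Num.Theory.
Local Open Scope ring_scope.

(** * One-variable calculus: a quadratic lower bound for the logistic loss *)

(** The affine argument serves twice: with [k = 1] for a moving margin, and with [k] an inner
    product for the loss restricted to a line. *)
Lemma is_derive_logloss (R : realType) (y z k s : R) :
  is_derive s 1 (fun s => logloss (z + s * k) y)
    (- y / (1 + expR (y * (z + s * k))) * k).
Proof.
pose u (s : R) := - (y * (z + s * k)).
have du : is_derive s 1 u (- (y * k)).
  rewrite (_ : u = (cst (- (y * z))) + (- (y * k)) \*: (@id R)); last first.
    by apply/funext => r; rewrite /u /= !fctE /= /GRing.scale /=; ring.
  have D := is_deriveD (is_derive_cst (- (y * z)) s 1)
    (is_deriveZ (- (y * k)) (is_derive_id s 1)).
  apply: (is_derive_eq D).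
  by rewrite add0r /= /GRing.scale /= mulr1.
pose v := cst (1 : R) + (expR \o u).
have v0 : 0 < v s by rewrite /v /= fctE addr_gt0 ?expR_gt0.
have dl : is_derive (v s) 1 (@ln R) (v s)^-1 by exact: is_derive1_ln.
have -> : (fun s => logloss (z + s * k) y) = (@ln R) \o v by apply/funext.
have dv : is_derive s 1 v (expR (u s) * - (y * k)).
  have D := is_deriveD (is_derive_cst (1 : R) s 1)
    (is_derive1_comp (is_derive_expR (u s)) du).
  by apply: (is_derive_eq D); rewrite add0r.
apply: (is_derive_eq (is_derive1_comp dl dv)).
rewrite /v !fctE /= /u expRN.
have e0 := expR_gt0 (y * (z + s * k)).
by field; rewrite lt0r_neq0 // lt0r_neq0 ?addr_gt0.
Qed.

Lemma ge0_derive_ge (R : realType) (f df : R -> R) (a b : R) :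
  a <= b -> (forall s, a <= s <= b -> is_derive s 1 f (df s)) ->
  (forall s, a <= s <= b -> 0 <= df s) -> f a <= f b.
Proof.
move=> ab fdf df0.
have [||c cab] := @MVT_segment R f df a b ab.
- by move=> s sab; apply: fdf; rewrite !ltW ?(itvP sab).
- apply: derivable_within_continuous => s sab.
  by have [] := fdf s; rewrite ?(itvP sab).
by move=> e; rewrite -subr_ge0 e mulr_ge0 ?subr_ge0 // df0 ?(itvP cab).
Qed.

(** The difference has derivative [expR s + expR (- s) - 2], which is nonnegative because the two
    exponentials have product 1. *)
Lemma sinh_ge (R : realType) (k : R) :
  0 <= k -> 2 * k <= expR k - expR (- k).
Proof.
move=> k0.
pose f : R -> R := expR + (- (expR \o -%R)) + (- 2) \*: (@id R).
suff : f 0 <= f k by rewrite /f !fctE /= /GRing.scale /= oppr0 expR0; lra.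
have df (s : R) : is_derive s 1 f (expR s + expR (- s) - 2).
  have dN : is_derive s 1 (-%R : R -> R) (- 1).
    exact: is_deriveN (is_derive_id _ _).
  have D := is_deriveD (is_deriveD (is_derive_expR s)
    (is_deriveN (is_derive1_comp (is_derive_expR (- s)) dN)))
    (is_deriveZ (- 2) (is_derive_id s 1)).
  by apply: (is_derive_eq D); rewrite /= /GRing.scale /=; ring.
apply: (@ge0_derive_ge _ f _ _ _ k0 (fun s _ => df s)) => s _.
have := expR_gt0 s; have := expR_gt0 (- s).
have : expR s * expR (- s) = 1 by rewrite expRN mulfV // gt_eqF ?expR_gt0.
by have := sqr_ge0 (expR s - expR (- s)); nra.
Qed.

(* With [k = s - C], the boundary case [s >= C] rests on [k <= sinh k]. *)
Lemma sigmoid_increment_ge (R : realType) (C a s : R) :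
  0 <= C -> 0 <= s -> a + s <= C ->
  s * (1 + expR (- (a + s))) <= (1 + C) * (1 - expR (- s)) * (1 + expR (- a)).
Proof.
move=> C0 s0 asC.
(* With [b = expR (- (a + s))], [U = expR s] and [V = expR (- s)], both sides are affine in [b]: the
   right one is [(1 + C) * (1 - V + b * (U - 1))]. The constraint on [b] is [b >= expR (- C)]. *)
have -> : - a = - (a + s) + s by ring.
rewrite expRD.
set b := expR (- (a + s)).
have bC : expR (- C) <= b by rewrite ler_expR; lra.
have b0 : 0 < b by exact: expR_gt0.
have U1 := expR_ge1Dx s.
have UV : expR s * expR (- s) = 1 by rewrite expRN mulfV // gt_eqF ?expR_gt0.
have V0 := expR_gt0 (- s).
move: U1 UV V0; set U := expR s; set V := expR (- s) => U1 UV V0.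
have V1 : s <= (1 + s) * (1 - V) by nra.
have [sC|Cs] := leP s C.
  (* For [s <= C] the affine functions compare coefficient by coefficient: [h1] for the constant
     terms, [h2] for the slopes. *)
  have h1 : s <= (1 + C) * (1 - V) by nra.
  have h2 : s <= (1 + C) * (U - 1) by nra.
  have -> : (1 + C) * (1 - V) * (1 + b * U)
          = (1 + C) * (1 - V) + b * ((1 + C) * (U * 1 - U * V)) by ring.
  by rewrite UV mulr1; nra.
(* For [s > C] the constant terms can compare the wrong way. The inequality is proved at the
   smallest admissible value [b = expR (- C)], which is [E3], and extended to larger [b] by
   comparing slopes. *)
have k0 : 0 <= s - C by lra.
have cC := expR_ge1Dx C.
have cU : expR (- C) * U = expR (s - C) by rewrite /U -expRD; congr expR; ring.
have cV : expR (- C) * expR (- (s - C)) = V by rewrite /V -expRD; congr expR; ring.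
have ccC : expR (- C) * expR C = 1 by rewrite -expRD addNr expR0.
have W1 := expR_ge1Dx (- (s - C)).
have KW := sinh_ge _ _ k0.
have c0 := expR_gt0 (- C).
have c1 : expR (- C) <= 1 by rewrite -expR0 ler_expR; lra.
move: bC cC cU cV ccC W1 KW c0 c1.
set c := expR (- C); set W := expR (- (s - C)); set K := expR (s - C).
move=> bc cC cU cV ccC W1 KW c0 c1.
have E1 : C <= (1 + C) * (1 - c) by nra.
(* Split [K - c * W] as [(K - W) + (1 - c) * W], then use [K - W >= 2 * (s - C)] and
   [W >= 1 - (s - C)]. *)
have E2 : 2 * (1 - c) + (s - C) * (1 + c) <= 1 - V + c * (U - 1).
  have -> : 1 - V + c * (U - 1) = 1 - c * W + K - c by rewrite -cU -cV; ring.
  by nra.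
have E3 : s * (1 + c) <= (1 + C) * (1 - V + c * (U - 1)).
  have : (1 + C) * (2 * (1 - c) + (s - C) * (1 + c))
     <= (1 + C) * (1 - V + c * (U - 1)) by rewrite ler_pM2l //; lra.
  have : 0 <= C * ((s - C) * (1 + c)) by rewrite !mulr_ge0 //; lra.
  by nra.
have -> : (1 + C) * (1 - V) * (1 + b * U)
        = (1 + C) * (1 - V + c * (U - 1)) + (b - c) * ((1 + C) * (U - 1))
          + (1 + C) * b * (1 - U * V) by ring.
rewrite UV.
have : s <= (1 + C) * (U - 1) by nra.
by nra.
Qed.

(** Right side minus left side vanishes at [h = 0], and its derivative in [h] is a nonnegative
    factor times the gap in [sigmoid_increment_ge]. *)
Lemma softplus_bregman_ge (R : realType) (C a h : R) :
  0 <= C -> 0 <= h -> a + h <= C ->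
  ln (1 + expR (- a)) - h / (1 + expR a)
    + expR a / (1 + C) / 2 * (h / (1 + expR a)) ^+ 2
  <= ln (1 + expR (- (a + h))).
Proof.
move=> C0 h0 ahC.
pose p := (1 + expR a)^-1.
pose c := expR a / (1 + C) / 2 * p ^+ 2.
pose f : R -> R := (fun s => logloss (a + s * 1) 1) + (p \*: @id R)
   - (c \*: (@id R ^+ 2)).
suff : f 0 <= f h.
  rewrite /f !fctE /= /GRing.scale /= /logloss !mulr1 !mul1r addr0 mulr0 expr0n /=.
  by rewrite mulr0 /c -/p exprMn; lra.
pose f' (s : R) := - 1 / (1 + expR (1 * (a + s * 1))) * 1 + p * 1 - c * (2 * s).
have ea0 := expR_gt0 a.
have df (s : R) : is_derive s 1 f (f' s).
  have D := is_deriveB (is_deriveD (is_derive_logloss _ 1 a 1 s)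
    (is_deriveZ p (is_derive_id s 1)))
    (is_deriveZ c (is_deriveX 2 (is_derive_id s 1))).
  by rewrite /f'; apply: (is_derive_eq D); rewrite /= /GRing.scale /= expr1 !mulr1.
apply: (@ge0_derive_ge _ f f' _ _ h0 (fun s _ => df s)) => s /andP[s0 sh].
have := @sigmoid_increment_ge _ C a s C0 s0 _.
have -> : a + s <= C by lra.
move=> /(_ isT); rewrite !expRN.
rewrite /f' !mulr1 mul1r /c /p expRD.
have es0 := expR_gt0 s.
move: ea0 es0; set A := expR a; set S := expR s => A0 S0 H.
have C1 : 0 < 1 + C by lra.
have A1 : 0 < 1 + A by lra.
have AS1 : 0 < 1 + A * S by rewrite addr_gt0 // mulr_gt0.
have -> : - 1 / (1 + A * S) + (1 + A)^-1 - A / (1 + C) / 2 * (1 + A)^-1 ^+ 2 * (2 * s)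
   = A / ((1 + C) * (1 + A) * (1 + A * S)) * (S * A / (1 + A)) *
   ((1 + C) * (1 - S^-1) * (1 + A^-1) - s * (1 + (A * S)^-1)).
  by field; rewrite !gt_eqF.
apply: mulr_ge0; last by lra.
by rewrite !(divr_ge0, mulr_ge0) //; exact: ltW.
Qed.

(** Only [b] is bounded; [a] is arbitrary. The case of [b] below [a] follows from the other one by
    the reflection [z -> - z], which changes the loss by a linear term and preserves its second
    derivative [expR a / (1 + expR a) ^+ 2]. *)
Lemma logloss_quadratic_lower (R : realType) (C a b : R) :
  0 <= C -> `|b| <= C ->
  ln (1 + expR (- a)) - (b - a) / (1 + expR a)
    + expR a / (1 + C) / 2 * ((b - a) / (1 + expR a)) ^+ 2
  <= ln (1 + expR (- b)).
Proof.
move=> C0; rewrite ler_norml => /andP[bC1 bC2].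
have [ab|/ltW ba] := leP a b.
  have := @softplus_bregman_ge _ C a (b - a) C0.
  by rewrite subrKC; apply; lra.
have flip (z : R) : ln (1 + expR z) = ln (1 + expR (- z)) + z.
  have -> : 1 + expR z = (1 + expR (- z)) * expR z.
    by rewrite mulrDl mul1r -expRD addNr expR0 addrC.
  by rewrite lnM ?expRK // posrE ?expR_gt0 // addr_gt0 ?expR_gt0.
have := @softplus_bregman_ge _ C (- a) (a - b) C0.
have -> : - a + (a - b) = - b by ring.
rewrite !opprK => /(_ _ _)/wrap[||]; [lra|lra|].
rewrite (flip a) (flip b) expRN.
have ea0 := expR_gt0 a.
move: ea0; set A := expR a => A0.
have C1 : 0 < 1 + C by lra.
have A1 : 0 < 1 + A by lra.
have -> : (a - b) / (1 + A^-1) = (a - b) - (a - b) / (1 + A).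
  by field; rewrite !gt_eqF // addrC.
have -> : A^-1 / (1 + C) / 2 * (a - b - (a - b) / (1 + A)) ^+ 2 =
  A / (1 + C) / 2 * ((b - a) / (1 + A)) ^+ 2.
  by field; rewrite !gt_eqF // addrC.
have -> : (b - a) / (1 + A) = - ((a - b) / (1 + A)) by rewrite -mulNr opprB.
by rewrite sqrrN; lra.
Qed.

(** * Determinants: rank-one updates and Hadamard's inequality *)

(** The bordered matrix [M] is factored through the Schur complement of either diagonal block; its
    determinant is then read off in two ways. *)
Lemma det_rank_one_update (F : comPzRingType) (n : nat) (u : 'cV[F]_n) (v : 'rV[F]_n) :
  \det (1%:M - u *m v) = 1 - (v *m u) 0 0.
Proof.
pose M := block_mx 1%:M v u 1%:M.
have e1 : M = block_mx 1%:M 0 u 1%:M *m block_mx 1%:M v 0 (1%:M - u *m v).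
  rewrite mulmx_block !mul1mx !mul0mx !mulmx1 ?mulmx0 !addr0.
  by rewrite addrC subrK.
have e2 : M = block_mx (1%:M - v *m u) v 0 1%:M *m block_mx 1%:M 0 u 1%:M.
  by rewrite mulmx_block !mulmx1 !mul0mx !mulmx0 !add0r !mul1mx subrK.
have : \det M = \det M by [].
rewrite {1}e1 e2 !det_mulmx !det_lblock !det_ublock !det1 !mul1r !mulr1 => ->.
by rewrite [in LHS](mx11_scalar (_ - _)) det_scalar1 !mxE eqxx.
Qed.

Lemma mulmx_trC (F : comPzRingType) (n : nat) (u v : 'rV[F]_n) :
  (u *m v^T) 0 0 = (v *m u^T) 0 0.
Proof.
have : (u *m v^T)^T 0 0 = (u *m v^T) 0 0 by rewrite mxE.
by rewrite trmx_mul trmxK => ->.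
Qed.

Lemma sym_formD (F : comPzRingType) (n : nat) (A : 'M[F]_n) (u v : 'rV[F]_n) :
  A^T = A -> ((u + v) *m A *m (u + v)^T) 0 0
  = (u *m A *m u^T) 0 0 + (v *m A *m u^T) 0 0 *+ 2 + (v *m A *m v^T) 0 0.
Proof.
move=> symA; have uAv : (u *m A *m v^T) 0 0 = (v *m A *m u^T) 0 0.
  by rewrite mulmx_trC trmx_mul symA mulmxA.
have -> : (u + v) *m A *m (u + v)^T
    = u *m A *m u^T + u *m A *m v^T + (v *m A *m u^T + v *m A *m v^T).
  by rewrite linearD /= !mulmxDl !mulmxDr.
by rewrite mxE [X in X + _]mxE uAv [X in _ + X = _]mxE mulr2n !addrA.
Qed.

(** Induction by the Schur complement [S] of the top left entry [r]: [\det A = r * \det S], [S] is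
    again positive definite, and its diagonal entries are at most those of [A]. *)
Lemma hadamard_posdef (F : realFieldType) (n : nat) (A : 'M[F]_n) :
  A^T = A -> (forall v : 'rV_n, v != 0 -> 0 < (v *m A *m v^T) 0 0) ->
  0 < \det A <= \prod_i A i i.
Proof.
elim: n A => [|n IHn] A symA posA.
  by rewrite det_mx00 big_ord0 ltr01 lexx.
move: A symA posA; rewrite -[n.+1]/(1 + n)%N => A symA posA.
pose a := ulsubmx A; pose b := ursubmx A; pose C := drsubmx A.
have AE : A = block_mx a b b^T C.
  by rewrite -[LHS]submxK /b trmx_ursub symA.
have symC : C^T = C by rewrite /C trmx_drsub symA.
have aE : a = (a 0 0)%:M by rewrite -mx11_scalar.
set r := a 0 0 in aE.
have formE (s : F) (v : 'rV_n) :
   (row_mx s%:M v *m A *m (row_mx s%:M v)^T) 0 0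
   = r * s ^+ 2 + 2 * s * (b *m v^T) 0 0 + (v *m C *m v^T) 0 0.
  rewrite AE mul_row_block tr_row_mx mul_row_col aE tr_scalar_mx.
  rewrite mul_mx_scalar !mul_scalar_mx mulmxDl -scalemxAl.
  have := mulmx_trC _ _ v b.
  by rewrite !mxE /= => ->; rewrite mulr1n; ring.
have r0 : 0 < r.
  have := posA (row_mx 1%:M 0); rewrite formE trmx0 !mulmx0 !mxE.
  rewrite !mulr0 !addr0 expr1n mulr1; apply.
  apply/eqP => /matrixP /(_ 0 (lshift n 0)); rewrite row_mxEl !mxE eqxx.
  by move/eqP; rewrite oner_eq0.
pose S := C - r^-1 *: (b^T *m b).
have detA : \det A = r * \det S.
  have -> : A = block_mx 1%:M 0 (r^-1 *: b^T) 1%:M *m block_mx a b 0 S.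
    rewrite mulmx_block !mul1mx !mul0mx ?mulmx0 !addr0 {1}AE; congr block_mx.
      by rewrite aE mul_mx_scalar scalerA mulfV ?scale1r ?gt_eqF.
    by rewrite /S scalemxAl addrC subrK.
  by rewrite det_mulmx det_lblock det_ublock !det1 !mul1r {1}aE det_scalar1.
have posS (v : 'rV_n) : v != 0 -> 0 < (v *m S *m v^T) 0 0.
  move=> v0; set be := (b *m v^T) 0 0.
  (* The first coordinate [- be / r] minimizes the form of [A] for fixed [v], and the minimum is the
     form of [S] at [v]. *)
  have := posA (row_mx (- be / r)%:M v); rewrite formE -/be.
  have -> : (v *m S *m v^T) 0 0 = (v *m C *m v^T) 0 0 - r^-1 * be ^+ 2.
    rewrite /S mulmxBr mulmxBl -scalemxAr -scalemxAl.
    have -> : v *m (b^T *m b) *m v^T = (be ^+ 2)%:M.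
      rewrite mulmxA -mulmxA [v *m b^T]mx11_scalar mul_scalar_mx.
      by rewrite mulmx_trC -/be [b *m v^T]mx11_scalar scale_scalar_mx.
    by rewrite !mxE mulr1n.
  have -> : r * (- be / r) ^+ 2 + 2 * (- be / r) * be = - (r^-1 * be ^+ 2).
    by field; rewrite gt_eqF.
  rewrite addrC; apply; apply: contra_neq v0 => e.
  by rewrite -[v](row_mxKr (- be / r)%:M) e linear0.
have /andP[S0 SE] : 0 < \det S <= \prod_i S i i.
  apply: IHn => //.
  by rewrite /S linearB linearZ /= trmx_mul trmxK symC.
rewrite detA mulr_gt0 //=.
rewrite big_split_ord /= big_ord1.
have -> : A (lshift n 0) (lshift n 0) = r by rewrite /r !mxE.
rewrite ler_pM2l //; apply: le_trans SE _.
have Sii i : S i i = A (rshift 1 i) (rshift 1 i) - r^-1 * (b 0 i) ^+ 2.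
  by rewrite !mxE big_ord1 !mxE expr2.
apply: ler_prod => i _; apply/andP; split.
  (* Comparing products factor by factor requires [S i i] to be nonnegative; a basis vector shows
     it. *)
  have := posS (delta_mx 0 i).
  rewrite -rowE trmx_delta -colE !mxE => /(_ _)/ltW; apply.
  apply/eqP => /matrixP /(_ 0 i); rewrite !mxE !eqxx.
  by move/eqP; rewrite oner_eq0.
by rewrite Sii gerBl mulr_ge0 ?sqr_ge0 // invr_ge0 ltW.
Qed.

Lemma ln_det_le_trace (R : realType) (n : nat) (A : 'M[R]_n) :
  (0 < n)%N -> A^T = A ->
  (forall v : 'rV_n, v != 0 -> 0 < (v *m A *m v^T) 0 0) ->
  ln (\det A) <= n%:R * ln (\tr A / n%:R).
Proof.
move=> n0 symA posA.
have /andP[detA0 detA] := hadamard_posdef _ _ _ symA posA.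
have diag0 i : 0 < A i i.
  have := posA (delta_mx 0 i).
  rewrite -rowE trmx_delta -colE !mxE; apply.
  apply/eqP => /matrixP /(_ 0 i); rewrite !mxE !eqxx.
  by move/eqP; rewrite oner_eq0.
have tr0 : 0 < \tr A / n%:R.
  rewrite divr_gt0 ?ltr0n // /mxtrace (bigD1 (Ordinal n0)) //=.
  by rewrite ltr_pwDl // sumr_ge0 // => i _; exact: ltW.
rewrite mulr_natl -lnXn // ler_ln ?posrE ?exprn_gt0 //.
apply: le_trans detA _.
have := leif_AGM (A := predT) (E := fun i => A i i) (fun i _ => ltW (diag0 i)).
by rewrite cardT size_enum_ord => -[].
Qed.

(** Here [w] stands for [g] times the inverse of [A]. Removing the rank-one term multiplies the
    determinant by [1 - c * (g *m w^T) 0 0], and [ln (1 - r) <= - r]. *)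
Lemma ln_det_rank_one (R : realType) (n : nat) (A : 'M[R]_n) (g w : 'rV[R]_n)
    (c : R) :
  0 < \det A -> 0 < \det (A - c *: (g^T *m g)) -> A^T = A -> w *m A = g ->
  c * (g *m w^T) 0 0 <= ln (\det A) - ln (\det (A - c *: (g^T *m g))).
Proof.
move=> detA detA' symA wA.
have E : \det (A - c *: (g^T *m g)) = \det A * (1 - c * (g *m w^T) 0 0).
  have -> : A - c *: (g^T *m g) = A *m (1%:M - (c *: w^T) *m g).
    rewrite mulmxBr mulmx1 -scalemxAl -scalemxAr mulmxA.
    by rewrite -[in g^T]wA trmx_mul symA.
  by rewrite det_mulmx det_rank_one_update -scalemxAr mxE.
move: detA'; rewrite E pmulr_rgt0 // => u1.
rewrite lnM ?posrE //.
have := @le_ln1Dx R (- (c * (g *m w^T) 0 0)) _; lra.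
Qed.

(** * The Euclidean inner product *)

Lemma dotp_mx (R : realType) (d : nat) (u v : 'rV[R]_d) :
  dotp u v = (u *m v^T) 0 0.
Proof. by rewrite mxE; apply: eq_bigr => i _; rewrite mxE. Qed.

Lemma dotpC (R : realType) (d : nat) (u v : 'rV[R]_d) : dotp u v = dotp v u.
Proof. by rewrite !dotp_mx mulmx_trC. Qed.

Lemma dotpDl (R : realType) (d : nat) (u v w : 'rV[R]_d) :
  dotp (u + v) w = dotp u w + dotp v w.
Proof. by rewrite !dotp_mx mulmxDl mxE. Qed.

Lemma dotpDr (R : realType) (d : nat) (u v w : 'rV[R]_d) :
  dotp w (u + v) = dotp w u + dotp w v.
Proof. by rewrite dotpC dotpDl !(dotpC _ _ w). Qed.

Lemma dotpZl (R : realType) (d : nat) (a : R) (u v : 'rV[R]_d) :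
  dotp (a *: u) v = a * dotp u v.
Proof. by rewrite !dotp_mx -scalemxAl mxE. Qed.

Lemma dotpZr (R : realType) (d : nat) (a : R) (u v : 'rV[R]_d) :
  dotp u (a *: v) = a * dotp u v.
Proof. by rewrite dotpC dotpZl dotpC. Qed.

Lemma dotpBr (R : realType) (d : nat) (u v w : 'rV[R]_d) :
  dotp w (u - v) = dotp w u - dotp w v.
Proof. by rewrite dotpDr -scaleN1r dotpZr mulN1r. Qed.

Lemma dotp_ge0 (R : realType) (d : nat) (u : 'rV[R]_d) : 0 <= dotp u u.
Proof. by apply: sumr_ge0 => i _; rewrite -expr2 sqr_ge0. Qed.

Lemma dotp_gt0 (R : realType) (d : nat) (u : 'rV[R]_d) : u != 0 -> 0 < dotp u u.
Proof.
move=> u0; rewrite lt_def dotp_ge0 andbT; apply: contra_neq u0 => e.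
apply/rowP => i; rewrite mxE; apply/eqP.
rewrite -[_ == _]sqrf_eq0 expr2 (psumr_eq0P _ e) // => j _.
by rewrite -expr2 sqr_ge0.
Qed.

Lemma enorm_sqr (R : realType) (d : nat) (u : 'rV[R]_d) :
  enorm u ^+ 2 = dotp u u.
Proof. by rewrite sqr_sqrtr ?dotp_ge0. Qed.

(** Cauchy-Schwarz: for each sign [s], expand the nonnegative square norm of
    [b *: u + (- s * a) *: v] and divide by [2 * (a * b)]. *)
Lemma dotp_norm_le (R : realType) (d : nat) (u v : 'rV[R]_d) (a b : R) :
  0 < a -> 0 < b -> enorm u <= a -> enorm v <= b -> `|dotp u v| <= a * b.
Proof.
move=> a0 b0 ua vb.
have {}ua : dotp u u <= a ^+ 2.
  by rewrite -enorm_sqr ler_pXn2r ?nnegrE ?sqrtr_ge0 // ltW.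
have {}vb : dotp v v <= b ^+ 2.
  by rewrite -enorm_sqr ler_pXn2r ?nnegrE ?sqrtr_ge0 // ltW.
have key (s : R) : s ^+ 2 = 1 -> s * dotp u v <= a * b.
  move=> s1; have := dotp_ge0 _ _ (b *: u + (- s * a) *: v).
  rewrite !(dotpDl, dotpDr, dotpZl, dotpZr) (dotpC _ _ v u) => h.
  have : 2 * (a * b) * (s * dotp u v) <= 2 * (a * b) * (a * b).
    have -> : 2 * (a * b) * (s * dotp u v)
      = b ^+ 2 * dotp u u + s ^+ 2 * (a ^+ 2 * dotp v v) -
      (b * (b * dotp u u) + - s * a * (b * dotp u v) +
       (b * (- s * a * dotp u v) + - s * a * (- s * a * dotp v v))) by ring.
    rewrite s1; have := sqr_ge0 a; have := sqr_ge0 b; nra.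
  by rewrite ler_pM2l ?mulr_gt0.
rewrite ler_norml; apply/andP; split.
  by have := key (-1); rewrite sqrrN expr1n => /(_ erefl); lra.
by have := key 1; rewrite expr1n mul1r; apply.
Qed.

(** * Gram matrices and the growth of their log-determinant *)

(** The matrix [A_t] for arbitrary weights and directions. Vectors are rows, so [(g s)^T *m g s] is
    the outer product. *)
Definition gram (R : realType) (d : nat) (lam : R) (eta : nat -> R)
    (g : nat -> 'rV[R]_d) (t : nat) : 'M[R]_d :=
  (2 * lam)%:M + \sum_(s < t) eta s *: ((g s)^T *m g s).

Arguments gram {R d}.

Lemma gram_form (R : realType) (d : nat) (lam : R) (eta : nat -> R)
    (g : nat -> 'rV[R]_d) (t : nat) (v : 'rV[R]_d) :
  (v *m gram lam eta g t *m v^T) 0 0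
  = 2 * lam * dotp v v + \sum_(s < t) eta s * dotp (g s) v ^+ 2.
Proof.
rewrite /gram mulmxDr mulmxDl mul_mx_scalar -scalemxAl.
rewrite mulmx_sumr mulmx_suml mxE [X in X + _]mxE summxE -dotp_mx.
congr (_ + _); apply: eq_bigr => s _.
rewrite -scalemxAr -scalemxAl mxE mulmxA.
rewrite -[_ *m g s *m _]mulmxA [v *m _]mx11_scalar mul_scalar_mx mxE -!dotp_mx.
by rewrite expr2 (dotpC _ _ v).
Qed.

Lemma gram_sym (R : realType) (d : nat) (lam : R) (eta : nat -> R)
    (g : nat -> 'rV[R]_d) (t : nat) : (gram lam eta g t)^T = gram lam eta g t.
Proof.
rewrite /gram linearD /= tr_scalar_mx linear_sum /=; congr (_ + _).
by apply: eq_bigr => s _; rewrite linearZ /= trmx_mul trmxK.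
Qed.

Lemma gram_posdef (R : realType) (d : nat) (lam : R) (eta : nat -> R)
    (g : nat -> 'rV[R]_d) (t : nat) (v : 'rV[R]_d) :
  0 < lam -> (forall s, 0 <= eta s) -> v != 0 ->
  0 < (v *m gram lam eta g t *m v^T) 0 0.
Proof.
move=> lam0 eta0 v0; rewrite gram_form ltr_pwDl ?mulr_gt0 ?dotp_gt0 //.
by apply: sumr_ge0 => s _; rewrite mulr_ge0 ?sqr_ge0.
Qed.

Lemma det_gram_gt0 (R : realType) (d : nat) (lam : R) (eta : nat -> R)
    (g : nat -> 'rV[R]_d) (t : nat) :
  0 < lam -> (forall s, 0 <= eta s) -> 0 < \det (gram lam eta g t).
Proof.
move=> lam0 eta0.
have /andP[] // := hadamard_posdef _ _ _ (gram_sym R d lam eta g t)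
  (fun v => gram_posdef R d lam eta g t v lam0 eta0).
Qed.

(** The initial determinant is [(2 * lam) ^+ d], and the trace at [n] is [2 * lam * d] plus the sum
    of [eta s * dotp (g s) (g s)], hence at most [2 * lam * d + n * M]. *)
Lemma ln_det_gram_le (R : realType) (d : nat) (lam : R) (eta : nat -> R)
    (g : nat -> 'rV[R]_d) (n : nat) (M : R) :
  (0 < d)%N -> 0 < lam -> 0 <= M -> (forall s, 0 <= eta s) ->
  (forall s, (s < n)%N -> eta s * dotp (g s) (g s) <= M) ->
  ln (\det (gram lam eta g n)) - ln (\det (gram lam eta g 0))
  <= d%:R * ln (1 + n%:R * M / (2 * lam * d%:R)).
Proof.
move=> d0 lam0 M0 eta0 etaM.
have d0' : 0 < d%:R :> R by rewrite ltr0n.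
have nM0 : 0 <= n%:R * M / (2 * lam * d%:R).
  by rewrite divr_ge0 ?mulr_ge0 ?ler0n // ltW.
have -> : ln (\det (gram lam eta g 0)) = d%:R * ln (2 * lam).
  by rewrite /gram big_ord0 addr0 det_scalar lnXn ?mulr_gt0 // [RHS]mulr_natl.
rewrite lerBlDr -mulrDr -lnM ?posrE ?mulr_gt0 ?ltr_pwDl //.
apply: le_trans (ln_det_le_trace _ _ _ d0 (gram_sym R d lam eta g n)
  (fun v => gram_posdef R d lam eta g n v lam0 eta0)) _.
have trE : \tr (gram lam eta g n)
    = 2 * lam * d%:R + \sum_(s < n) eta s * dotp (g s) (g s).
  rewrite /gram mxtraceD mxtrace_scalar mulr_natr; congr (_ + _).
  rewrite raddf_sum; apply: eq_bigr => s _ /=.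
  by rewrite mxtraceZ mxtrace_mulC /mxtrace big_ord1 -dotp_mx.
have sum0 : 0 <= \sum_(s < n) eta s * dotp (g s) (g s).
  by apply: sumr_ge0 => s _; rewrite mulr_ge0 ?dotp_ge0.
have l0 : 0 < 2 * lam * d%:R by rewrite !mulr_gt0.
rewrite ler_pM2l // ler_ln ?posrE.
- have -> : (1 + n%:R * M / (2 * lam * d%:R)) * (2 * lam)
      = (2 * lam * d%:R + n%:R * M) / d%:R.
    by field; rewrite !gt_eqF.
  rewrite trE ler_pM2r ?invr_gt0 // lerD2l.
  rewrite mulr_natl -[n in _ *+ n]card_ord -sumr_const.
  by apply: ler_sum => s _; exact: etaM.
- by rewrite trE divr_gt0 // ltr_pwDl.
- by rewrite !mulr_gt0 // ltr_pwDl.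
Qed.

(** * First-order condition on a line, and quadratic models *)

(** Fermat's rule for the objective on a line through its minimizer: [L] and [Q] are the linear and
    quadratic coefficients of the surrogate part, [k] the rate at which the prediction moves. *)
Lemma logloss_stationary (R : realType) (L Q z k : R) :
  (forall s, logloss z 1 + logloss z (-1)
     <= s * L + s ^+ 2 * Q + logloss (z + s * k) 1 + logloss (z + s * k) (-1)) ->
  L = k * (1 / (1 + expR z) - 1 / (1 + expR (- z))).
Proof.
move=> H.
pose f : R -> R := L \*: (@id R) + Q \*: (@id R ^+ 2)
  + (fun s => logloss (z + s * k) 1) + (fun s => logloss (z + s * k) (-1)).
have df (s : R) : is_derive s 1 f (L + Q * (2 * s) + - 1 / (1 + expR (1 * (z + s * k))) * k
    + - (-1) / (1 + expR (-1 * (z + s * k))) * k).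
  have D := is_deriveD (is_deriveD (is_deriveD (is_deriveZ L (is_derive_id s 1))
    (is_deriveZ Q (is_deriveX 2 (is_derive_id s 1))))
    (is_derive_logloss _ 1 z k s)) (is_derive_logloss _ (-1) z k s).
  by apply: (is_derive_eq D); rewrite /= /GRing.scale /= expr1 !mulr1.
(* The interval from -1 to 1 is an arbitrary choice that makes 0 an interior point. *)
have := @derive1_at_min R f (-1) 1 0 _ _ _ _.
have -> : (-1 : R) <= 1 by lra.
have in0 : 0 \in `](-1 : R), 1[ by rewrite in_itv /=; apply/andP; split; lra.
move=> /(_ isT (fun t _ => @ex_derive _ _ _ _ _ _ _ (df t)) in0) /(_ _)/wrap[].
  move=> t _; rewrite /f !fctE /= /GRing.scale /= !(mul0r, mulr0, addr0, expr0n, add0r).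
  by have := H t; lra.
move=> [_]; rewrite (@derive_val _ _ _ _ _ _ _ (df 0)).
rewrite mul0r mulr0 mulr0 !addr0 (mul1r z) (mulN1r z) => e.
by apply: subr0_eq; rewrite -[RHS]e; ring.
Qed.

(** This is [L_t], regularizer included, with the values, gradients, curvatures and base points of
    the rounds abstracted into the sequences [c], [g], [eta], [p]. *)
Definition quad_model (R : realType) (d : nat) (lam : R) (c eta : nat -> R)
    (g p : nat -> 'rV[R]_d) (t : nat) (th : 'rV[R]_d) : R :=
  \sum_(s < t) (c s + dotp (g s) (th - p s)
     + eta s / 2 * dotp (g s) (th - p s) ^+ 2) + lam * dotp th th.
Arguments quad_model {R d}.

(** The directional derivative of [quad_model] at [q] along [v]. *)
Definition quad_slope (R : realType) (d : nat) (lam : R) (eta : nat -> R)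
    (g p : nat -> 'rV[R]_d) (t : nat) (q v : 'rV[R]_d) : R :=
  \sum_(s < t) ((1 + eta s * dotp (g s) (q - p s)) * dotp (g s) v)
  + 2 * lam * dotp q v.
Arguments quad_slope {R d}.

Lemma quad_slopeZ (R : realType) (d : nat) (lam : R) (eta : nat -> R)
    (g p : nat -> 'rV[R]_d) (t : nat) (q v : 'rV[R]_d) (a : R) :
  quad_slope lam eta g p t q (a *: v) = a * quad_slope lam eta g p t q v.
Proof.
rewrite /quad_slope [RHS]mulrDr [X in _ = X + _]mulr_sumr; congr (_ + _).
  by apply: eq_bigr => s _; rewrite dotpZr mulrCA.
by rewrite dotpZr mulrCA.
Qed.

(** Exact second-order Taylor expansion; the Hessian is the Gram matrix at every point. *)
Lemma quad_model_expand (R : realType) (d : nat) (lam : R) (c eta : nat -> R)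
    (g p : nat -> 'rV[R]_d) (t : nat) (q v : 'rV[R]_d) :
  quad_model lam c eta g p t (q + v) = quad_model lam c eta g p t q
    + quad_slope lam eta g p t q v + (v *m gram lam eta g t *m v^T) 0 0 / 2.
Proof.
rewrite gram_form /quad_model /quad_slope !(dotpDl, dotpDr) (dotpC _ _ v q).
have -> : \sum_(s < t) (c s + dotp (g s) (q + v - p s)
    + eta s / 2 * dotp (g s) (q + v - p s) ^+ 2)
  = \sum_(s < t) (c s + dotp (g s) (q - p s)
      + eta s / 2 * dotp (g s) (q - p s) ^+ 2)
    + \sum_(s < t) ((1 + eta s * dotp (g s) (q - p s)) * dotp (g s) v)
    + (\sum_(s < t) eta s * dotp (g s) v ^+ 2) / 2.
  rewrite [X in _ = _ + X]mulr_suml -!big_split /=.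
  by apply: eq_bigr => s _; rewrite (addrAC q) (dotpDr _ _ _ v); field.
by field.
Qed.

(* Comparing with [q = th + w], where [w] is [g t] times the inverse of the new
   Gram matrix, needs no minimizer of the quadratic model. *)
Lemma quad_model_step (R : realType) (d : nat) (lam K : R) (c eta : nat -> R)
    (g p : nat -> 'rV[R]_d) (t : nat) (th : 'rV[R]_d) :
  0 < lam -> 0 <= K -> (forall s, 0 <= eta s) ->
  (forall v, quad_slope lam eta g p t (p t) v = (K * eta t - 1) * dotp (g t) v) ->
  exists q, quad_model lam c eta g p t q + c t <= quad_model lam c eta g p t.+1 th
    + K * (ln (\det (gram lam eta g t.+1)) - ln (\det (gram lam eta g t))).
Proof.
move=> lam0 K0 eta0 slopeE.
have gramS : gram lam eta g t.+1 = gram lam eta g t + eta t *: ((g t)^T *m g t).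
  by rewrite /gram big_ord_recr /= addrA.
have gramB : gram lam eta g t.+1 - eta t *: ((g t)^T *m g t) = gram lam eta g t.
  by rewrite gramS addrK.
have det1 := det_gram_gt0 _ _ lam eta g t.+1 lam0 eta0.
have det0 := det_gram_gt0 _ _ lam eta g t lam0 eta0.
set A := gram lam eta g t.+1 in gramS gramB det1 *.
have symA : A^T = A := gram_sym _ _ _ _ _ _.
pose w := g t *m invmx A.
have wA : w *m A = g t.
  by rewrite /w -mulmxA mulVmx ?mulmx1 // unitmxE unitfE gt_eqF.
clearbody w.
pose u := dotp (g t) w.
have wAw : (w *m A *m w^T) 0 0 = u by rewrite wA -dotp_mx.
have u0 : 0 <= u.
  rewrite -wAw gram_form addr_ge0 ?mulr_ge0 ?dotp_ge0 //; first exact: ltW.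
  by apply: sumr_ge0 => s _; rewrite mulr_ge0 ?sqr_ge0.
have : eta t * u <= ln (\det A) - ln (\det (gram lam eta g t)).
  by rewrite /u dotp_mx -gramB; apply: ln_det_rank_one; rewrite ?gramB.
move/(ler_wpM2l K0) => Ku.
pose v := th - p t.
(* All values are expanded around [p t], where the slope is given by [slopeE]. *)
have thE : th = p t + v by rewrite addrC subrK.
exists (th + w).
have -> : quad_model lam c eta g p t.+1 th = quad_model lam c eta g p t th
    + (c t + dotp (g t) v + eta t / 2 * dotp (g t) v ^+ 2).
  by rewrite /quad_model big_ord_recr /=; ring.
have -> : th + w = p t + (v + w) by rewrite addrA -thE.
rewrite thE !quad_model_expand !slopeE.
have gE (x : 'rV_d) : (x *m gram lam eta g t *m x^T) 0 0
   = (x *m A *m x^T) 0 0 - eta t * dotp (g t) x ^+ 2.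
  rewrite !gram_form big_ord_recr /=; ring.
have AE : ((v + w) *m A *m (v + w)^T) 0 0
    = (v *m A *m v^T) 0 0 + 2 * dotp (g t) v + u.
  by rewrite sym_formD // wAw wA (dotp_mx _ _ _ v) mulr_natl.
rewrite !gE AE (dotpDr _ _ v w) -/u.
(* After cancellation, right side minus left side is [u / 2 + eta t / 2 * (dotp (g t) v + u) ^+ 2]
   plus the nonnegative slack in [Ku]. *)
have e0 := eta0 t; have : 0 <= eta t * (dotp (g t) v + u) ^+ 2.
  by rewrite mulr_ge0 ?sqr_ge0.
by lra.
Qed.

(** * The AIOLI iterates and their regret *)

Definition surrogate_sum (R : realType) (d : nat) (lam Rb B : R)
    (x : nat -> 'rV[R]_d) (y : nat -> R) (p : nat -> 'rV[R]_d) :=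
  quad_model lam (fun s => lossAt x y s (p s))
    (fun s => etaAt Rb B x y s (p s)) (fun s => gradAt x y s (p s)) p.
Arguments surrogate_sum {R d}.

Lemma surrogate_sumE (R : realType) (d : nat) (lam Rb B : R)
    (x : nat -> 'rV[R]_d) (y : nat -> R) (p : nat -> 'rV[R]_d) (t : nat)
    (th : 'rV[R]_d) :
  surrogate_sum lam Rb B x y p t th
  = \sum_(s < t) surrogate Rb B x y s (p s) th + lam * enorm th ^+ 2.
Proof. by rewrite enorm_sqr. Qed.

(** The scalar bound at [C = B * Rb], applied to the margins of [q] and [th]. Only [th] has to lie
    in the ball, which suits iterates that range over the whole space. *)
Lemma surrogate_le_loss (R : realType) (d : nat) (Rb B : R)
    (x : nat -> 'rV[R]_d) (y : nat -> R) (t : nat) (q th : 'rV[R]_d) :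
  0 < Rb -> 0 < B -> enorm (x t) <= Rb -> y t = 1 \/ y t = -1 ->
  enorm th <= B -> surrogate Rb B x y t q th <= lossAt x y t th.
Proof.
move=> Rb0 B0 xR yt thB.
have ytn : `|y t| = 1 by case: yt => ->; rewrite ?normrN normr1.
have yb : `|y t * dotp th (x t)| <= B * Rb.
  by rewrite normrM ytn mul1r dotp_norm_le.
have BR0 : 0 <= B * Rb by rewrite mulr_ge0 // ltW.
have := logloss_quadratic_lower _ (B * Rb) (y t * dotp q (x t)) _ BR0 yb.
apply: le_trans; rewrite /surrogate /lossAt /logloss /gradAt /etaAt.
rewrite dotpZl dotpBr (dotpC _ _ (x t) th) (dotpC _ _ (x t) q).
set D := (1 + expR (y t * _)).
have -> : - y t / D * (dotp th (x t) - dotp q (x t))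
  = - ((y t * dotp th (x t) - y t * dotp q (x t)) / D) by ring.
by rewrite sqrrN.
Qed.

(** Of the two virtual losses in the objective, the one with the revealed label has gradient [g_t]
    at the iterate and the other has [- exp(y_t thhat_t.x_t) g_t]; stationarity makes the gradient
    of [L_t] cancel their sum. *)
Lemma aioli_slope (R : realType) (d : nat) (lam Rb B : R)
    (x : nat -> 'rV[R]_d) (y : nat -> R) (p : nat -> 'rV[R]_d) (t : nat)
    (v : 'rV[R]_d) :
  0 < Rb -> 0 < B -> y t = 1 \/ y t = -1 ->
  (forall th, aioli_obj lam Rb B x y p t (p t) <= aioli_obj lam Rb B x y p t th) ->
  quad_slope lam (fun s => etaAt Rb B x y s (p s))
    (fun s => gradAt x y s (p s)) p t (p t) v
  = ((1 + B * Rb) * etaAt Rb B x y t (p t) - 1) * dotp (gradAt x y t (p t)) v.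
Proof.
move=> Rb0 B0 yt pmin.
have objE th : aioli_obj lam Rb B x y p t th = surrogate_sum lam Rb B x y p t th
    + logloss (dotp th (x t)) 1 + logloss (dotp th (x t)) (-1).
  by rewrite surrogate_sumE /aioli_obj; ring.
set z := dotp (p t) (x t).
have BR0 : 0 < 1 + B * Rb by rewrite ltr_wpDr // mulr_ge0 // ltW.
apply: etrans (logloss_stationary _ _ ((v *m gram lam (fun s => etaAt Rb B x y s (p s))
    (fun s => gradAt x y s (p s)) t *m v^T) 0 0 / 2) z (dotp v (x t)) _) _; last first.
  rewrite /etaAt /gradAt dotpZl (dotpC _ _ (x t) v) -/z.
  have e0 := expR_gt0 z.
  case: yt => ->; rewrite ?mul1r ?mulN1r !expRN;
  by field; rewrite !gt_eqF // addr_gt0.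
move=> s; have := pmin (p t + s *: v); rewrite !objE /surrogate_sum.
rewrite quad_model_expand quad_slopeZ dotpDl dotpZl -/z.
rewrite linearZ /= -!scalemxAl -scalemxAr !scalerA [X in X / 2]mxE.
lra.
Qed.

(** Induction on [t] with [quad_model_step] at [K = 1 + B * Rb]. That step trades [th] for another
    point [q], so the bound is quantified over all [th]; the log-determinants telescope. *)
Lemma aioli_cumulative_loss (R : realType) (d n : nat) (lam Rb B : R)
    (x : nat -> 'rV[R]_d) (y : nat -> R) (p : nat -> 'rV[R]_d) :
  0 < lam -> 0 < Rb -> 0 < B ->
  (forall t, (t < n)%N -> y t = 1 \/ y t = -1) ->
  is_aioli lam Rb B n x y p ->
  let A := gram lam (fun s => etaAt Rb B x y s (p s))
    (fun s => gradAt x y s (p s)) in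
  forall t, (t <= n)%N -> forall th,
  \sum_(s < t) lossAt x y s (p s) <= surrogate_sum lam Rb B x y p t th
    + (1 + B * Rb) * (ln (\det (A t)) - ln (\det (A 0%N))).
Proof.
move=> lam0 Rb0 B0 y1 pmin A.
have BR0 : 0 < 1 + B * Rb by rewrite ltr_wpDr // mulr_ge0 // ltW.
have eta0 s : 0 <= etaAt Rb B x y s (p s).
  by rewrite divr_ge0 ?expR_ge0 // ltW.
elim=> [_|t IHt tn] th.
  rewrite big_ord0 subrr mulr0 addr0 surrogate_sumE big_ord0 add0r.
  by rewrite mulr_ge0 ?sqr_ge0 // ltW.
have [q] := quad_model_step _ _ lam (1 + B * Rb) (fun s => lossAt x y s (p s))
  (fun s => etaAt Rb B x y s (p s)) (fun s => gradAt x y s (p s)) p t th lam0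
  (ltW BR0) eta0
  (fun v => aioli_slope _ _ _ _ _ _ _ _ _ v Rb0 B0 (y1 t tn) (pmin t tn)).
have := IHt (ltnW tn) q.
by rewrite big_ord_recr /= -/A /surrogate_sum; lra.
Qed.

(** The 4 comes from [E / (1 + E) ^+ 2 <= 1 / 4]. Together with the 2 in [2 * lam] it gives the 8 of
    the regret bound. *)
Lemma eta_grad_sqr_le (R : realType) (d : nat) (Rb B : R)
    (x : nat -> 'rV[R]_d) (y : nat -> R) (t : nat) (q : 'rV[R]_d) :
  0 < Rb -> 0 < B -> enorm (x t) <= Rb -> y t = 1 \/ y t = -1 ->
  etaAt Rb B x y t q * dotp (gradAt x y t q) (gradAt x y t q)
  <= Rb ^+ 2 / (4 * (1 + B * Rb)).
Proof.
move=> Rb0 B0 xR yt.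
have BR0 : 0 < 1 + B * Rb by rewrite ltr_wpDr // mulr_ge0 // ltW.
have y2 : y t ^+ 2 = 1 by case: yt => ->; rewrite ?sqrrN expr1n.
have xx : dotp (x t) (x t) <= Rb ^+ 2.
  by rewrite -enorm_sqr ler_pXn2r ?nnegrE ?sqrtr_ge0 // ltW.
rewrite /etaAt /gradAt dotpZl dotpZr.
set E := expR _; have E0 : 0 < E by exact: expR_gt0.
have -> : E / (1 + B * Rb)
    * (- y t / (1 + E) * (- y t / (1 + E) * dotp (x t) (x t)))
  = y t ^+ 2 * (4 * E / (1 + E) ^+ 2) * (dotp (x t) (x t) / (4 * (1 + B * Rb))).
  by field; rewrite !gt_eqF // addr_gt0.
have EE : 4 * E / (1 + E) ^+ 2 <= 1.
  rewrite ler_pdivrMr ?exprn_gt0 ?addr_gt0 // mul1r.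
  by have := sqr_ge0 (1 - E); lra.
have K0 : 0 < 4 * (1 + B * Rb) by rewrite mulr_gt0.
rewrite y2 mul1r -[leRHS]mul1r ler_pM // ?ler_pM2r ?invr_gt0 //.
  by rewrite divr_ge0 ?sqr_ge0 // mulr_ge0 // ltW.
by rewrite divr_ge0 ?dotp_ge0 // ltW.
Qed.

Lemma aioli_regret (R : realType) (lam Rb B : R) (d n : nat)
    (x : nat -> 'rV[R]_d) (y : nat -> R) (p : nat -> 'rV[R]_d)
    (th : 'rV[R]_d) :
  0 < lam -> 0 < Rb -> 0 < B -> (1 <= d)%N ->
  (forall t, (t < n)%N -> enorm (x t) <= Rb) ->
  (forall t, (t < n)%N -> y t = 1 \/ y t = -1) ->
  is_aioli lam Rb B n x y p -> enorm th <= B ->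
  regret n x y p th <= lam * enorm th ^+ 2
    + d%:R * (1 + B * Rb)
      * ln (1 + n%:R * Rb ^+ 2 / (8 * d%:R * (1 + B * Rb) * lam)).
Proof.
move=> lam0 Rb0 B0 d0 xR y1 pmin thB.
have BR0 : 0 < 1 + B * Rb by rewrite ltr_wpDr // mulr_ge0 // ltW.
have d0' : 0 < d%:R :> R by rewrite ltr0n.
have eta0 s : 0 <= etaAt Rb B x y s (p s).
  by rewrite divr_ge0 ?expR_ge0 // ltW.
have := aioli_cumulative_loss _ _ n _ _ _ _ _ _ lam0 Rb0 B0 y1 pmin n (leqnn n) th.
rewrite /= surrogate_sumE.
have : \sum_(s < n) surrogate Rb B x y s (p s) th <= \sum_(s < n) lossAt x y s th.
  by apply: ler_sum => s _; apply: surrogate_le_loss; auto.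
have M0 : 0 <= Rb ^+ 2 / (4 * (1 + B * Rb)).
  by rewrite divr_ge0 ?sqr_ge0 // mulr_ge0 // ltW.
have := ln_det_gram_le _ _ lam _ (fun s => gradAt x y s (p s)) n _ d0 lam0 M0 eta0
  (fun s sn => eta_grad_sqr_le _ _ _ _ _ _ _ _ Rb0 B0 (xR s sn) (y1 s sn)).
have -> : n%:R * (Rb ^+ 2 / (4 * (1 + B * Rb))) / (2 * lam * d%:R)
  = n%:R * Rb ^+ 2 / (8 * d%:R * (1 + B * Rb) * lam).
  by field; rewrite !gt_eqF.
(* The log-determinant bound is scaled by [1 + B * Rb] to match its weight in the cumulative loss
   bound. *)
rewrite -(ler_pM2l BR0) /regret.
by lra.
Qed.

Theorem theorem1 (R : realType) (lam Rb B : R) (d n : nat)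
  (x : nat -> 'rV[R]_d) (y : nat -> R) :
  0 < lam -> 0 < Rb -> 0 < B -> (1 <= d)%N -> (1 <= n)%N ->
  (forall t, (t < n)%N -> enorm (x t) <= Rb) ->
  (forall t, (t < n)%N -> y t = 1 \/ y t = -1) ->
  (forall thhat : nat -> 'rV[R]_d, is_aioli lam Rb B n x y thhat ->
    forall th : 'rV[R]_d, enorm th <= B ->
      regret n x y thhat th <=
        lam * enorm th ^+ 2
        + d%:R * (1 + B * Rb)
          * ln (1 + n%:R * Rb ^+ 2 / (8 * d%:R * (1 + B * Rb) * lam)))
  /\
  (forall thhat : nat -> 'rV[R]_d, is_aioli (B ^+ 2)^-1 Rb B n x y thhat ->
    forall th : 'rV[R]_d, enorm th <= B ->
      regret n x y thhat th <=
        d%:R * (1 + B * Rb)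
          * ln (1 + n%:R * B ^+ 2 * Rb ^+ 2 / (8 * d%:R * (1 + B * Rb))) + 1).
Proof.
move=> lam0 Rb0 B0 d0 n0 xR y1; split=> thhat pmin th thB.
  exact: aioli_regret.
have BR0 : 0 < 1 + B * Rb by rewrite ltr_wpDr // mulr_ge0 // ltW.
have l0 : 0 < (B ^+ 2)^-1 by rewrite invr_gt0 exprn_gt0.
apply: le_trans (aioli_regret _ _ _ _ _ _ _ _ _ _ l0 Rb0 B0 d0 xR y1 pmin thB) _.
have -> : n%:R * Rb ^+ 2 / (8 * d%:R * (1 + B * Rb) * (B ^+ 2)^-1)
  = n%:R * B ^+ 2 * Rb ^+ 2 / (8 * d%:R * (1 + B * Rb)).
  by field; rewrite !gt_eqF // ltr0n.
(* The logarithmic terms agree, and what remains is [enorm th ^+ 2 / B ^+ 2 <= 1]. *)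
rewrite addrC lerD2l mulrC ler_pdivrMr ?exprn_gt0 // mul1r.
by rewrite ler_pXn2r ?nnegrE ?sqrtr_ge0 // ltW.
Qed.
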